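(* The odd Heisenberg Lie superalgebra $H_m$ is $2$-capable if and only if $m=1$.
   Context: Lie superalgebras are over a fixed algebraically closed ground field. A Heisenberg Lie superalgebra is a finite-dimensional Lie superalgebra $L$ with $Z(L)=[L,L]$ and $\dim Z(L)=1$. $H_m$ ($m\ge 1$) denotes the Heisenberg Lie superalgebra with odd centre, of dimension $(m\mid m+1)$ (even dimension $m$, odd dimension $m+1$). Explicitly it has even basis $x_1,\dots,x_m$ and odd basis $y_1,\dots,y_m,z$ with nonzero brackets (up to supersymmetry) $[x_j,y_j]=z$ for $1\le j\le m$. For a Lie superalgebra $H$, $Z(H)$ is the centre and $Z_2(H)=\{x\in H\mid [x,H]\subseteq Z(H)\}$. A Lie superalgebra $L$ is $2$-capable if there exists a Lie superalgebra $H$ with $L\cong H/Z_2(H)$. *)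

(* Defs.v *)
From HB Require Import structures.
From mathcomp Require Import all_boot all_algebra generic_quotient ring_quotient.
From mathcomp Require Import boolp ring.

Set Implicit Arguments.
Unset Strict Implicit.
Unset Printing Implicit Defensive.

Import GRing.Theory.
Local Open Scope ring_scope.
Local Open Scope quotient_scope.

(* The Z/2-grading is indexed by bool: false is even, true is odd, and the
   sum of degrees is addb; lsdeg p x reads "x belongs to L_p".
   The last two axioms follow from the preceding ones when 2, resp. 3, is
   invertible in F; they are the usual additional requirements in small
   characteristic. *)
HB.mixin Record isLieSuperalgebra (F : fieldType) L of GRing.Lmodule F L := {
  lsdeg : bool -> L -> Prop;
  lsbr : L -> L -> L;
  lsdeg0 : forall p, lsdeg p 0;
  lsdegP : forall p a x y, lsdeg p x -> lsdeg p y -> lsdeg p (a *: x + y);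
  lsdeg_sum : forall x,
    exists x0 x1, [/\ lsdeg false x0, lsdeg true x1 & x = x0 + x1];
  lsdeg_direct : forall x, lsdeg false x -> lsdeg true x -> x = 0;
  lsbr_linearr : forall x, linear (lsbr x);
  lsbr_linearl : forall y, linear (lsbr^~ y);
  lsbr_deg : forall p q x y,
    lsdeg p x -> lsdeg q y -> lsdeg (p (+) q) (lsbr x y);
  lsbr_skew : forall p q x y, lsdeg p x -> lsdeg q y ->
    lsbr x y = - ((-1) ^+ (p && q) *: lsbr y x);
  lsbr_jacobi : forall p q x y z, lsdeg p x -> lsdeg q y ->
    lsbr x (lsbr y z) =
      lsbr (lsbr x y) z + (-1) ^+ (p && q) *: lsbr y (lsbr x z);
  lsbr_even : forall x, lsdeg false x -> lsbr x x = 0;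
  lsbr_odd : forall x, lsdeg true x -> lsbr x (lsbr x x) = 0
}.

#[short(type="lieSuperalgType")]
HB.structure Definition LieSuperalgebra (F : fieldType) :=
  {L of isLieSuperalgebra F L & GRing.Lmodule F L}.

Arguments lsbr_skew {F s p q x y}.
Arguments lsbr_jacobi {F s p q x y}.

Section Basics.
Variables (F : fieldType) (L : lieSuperalgType F).
Implicit Types x y z : L.

Lemma lsbr0r x : lsbr x 0 = 0.
Proof. by have := lsbr_linearr x (-1) 0 0; rewrite scaleN1r addNr scaleN1r addNr. Qed.

Lemma lsbr0l y : lsbr 0 y = 0.
Proof. by have := lsbr_linearl y (-1) 0 0; rewrite /= scaleN1r addNr scaleN1r addNr. Qed.

Lemma lsbrDr x y z : lsbr x (y + z) = lsbr x y + lsbr x z.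
Proof. by have := lsbr_linearr x 1 y z; rewrite !scale1r. Qed.

Lemma lsbrDl x y z : lsbr (x + y) z = lsbr x z + lsbr y z.
Proof. by have := lsbr_linearl z 1 x y; rewrite /= !scale1r. Qed.

Lemma lsbrZr a x y : lsbr x (a *: y) = a *: lsbr x y.
Proof. by have := lsbr_linearr x a y 0; rewrite lsbr0r !addr0. Qed.

Lemma lsbrZl a x y : lsbr (a *: x) y = a *: lsbr x y.
Proof. by have := lsbr_linearl y a x 0; rewrite /= lsbr0l !addr0. Qed.

Lemma lsbrBr x y z : lsbr x (y - z) = lsbr x y - lsbr x z.
Proof. by rewrite -scaleN1r lsbrDr lsbrZr scaleN1r. Qed.

Lemma lsbrBl x y z : lsbr (x - y) z = lsbr x z - lsbr y z.
Proof. by rewrite -scaleN1r lsbrDl lsbrZl scaleN1r. Qed.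

Lemma lsdegD p x y : lsdeg p x -> lsdeg p y -> lsdeg p (x + y).
Proof. by move=> px py; rewrite -[x]scale1r; apply: lsdegP. Qed.

Lemma lsdegZ p a x : lsdeg p x -> lsdeg p (a *: x).
Proof. by move=> px; rewrite -[_ *: _]addr0; apply: lsdegP => //; apply: lsdeg0. Qed.

Lemma lsdegN p x : lsdeg p x -> lsdeg p (- x).
Proof. by move=> px; rewrite -scaleN1r; apply: lsdegZ. Qed.

Lemma lsdeg_direct2 p x y : lsdeg p x -> lsdeg (~~ p) y -> x + y = 0 ->
  x = 0 /\ y = 0.
Proof.
move=> px py /eqP; rewrite addr_eq0 => /eqP exy.
suff y0 : y = 0 by rewrite exy y0 oppr0.
have py' : lsdeg p y by rewrite -[y]opprK -exy; apply: lsdegN.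
by case: p px py py' => ? ? ?; apply: lsdeg_direct.
Qed.

Lemma lsbr_skew0 x y : lsbr x y = 0 -> forall p, lsdeg p x -> lsbr y x = 0.
Proof.
move=> xy0 p px; have [y0 [y1 [d0 d1 ey]]] := lsdeg_sum y.
have [|||e0 e1] := @lsdeg_direct2 p (lsbr x y0) (lsbr x y1).
- by rewrite -[p]addbF; apply: lsbr_deg.
- by rewrite -addbT; apply: lsbr_deg.
- by rewrite -lsbrDr -ey.
by rewrite ey lsbrDl (lsbr_skew d0 px) (lsbr_skew d1 px) e0 e1 !scaler0 oppr0 addr0.
Qed.

End Basics.

(* Graded (two-sided) ideals, as decidable predicates *)
HB.mixin Record isGradedIdeal (F : fieldType) (L : lieSuperalgType F)
    (I : L -> bool) := {
  gideal_scale : forall a x, I x -> I (a *: x);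
  gideal_brl : forall x y, I x -> I (lsbr x y);
  gideal_brr : forall x y, I x -> I (lsbr y x);
  gideal_graded : forall x0 x1, lsdeg false x0 -> lsdeg true x1 ->
    I (x0 + x1) -> I x0 && I x1
}.

#[short(type="gradedIdeal")]
HB.structure Definition GradedIdeal (F : fieldType) (L : lieSuperalgType F) :=
  {I of isGradedIdeal F L I & GRing.ZmodClosed L I}.

Definition lsquot (F : fieldType) (L : lieSuperalgType F)
  (I : gradedIdeal L) : Type := Quotient.quot I.

Section Quotient.
Variables (F : fieldType) (L : lieSuperalgType F) (I : gradedIdeal L).
Local Notation Q := (lsquot I).

HB.instance Definition _ := GRing.Zmodule.on Q.
HB.instance Definition _ := Quotient.on Q.

Definition lspi (x : L) : Q := \pi_(Quotient.quot I) x.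

Lemma lspi_eq x y : lspi x = lspi y <-> x - y \in I.
Proof. by rewrite Quotient.idealrBE; split=> /eqP. Qed.

Lemma lspi_ind (P : Q -> Prop) : (forall x, P (lspi x)) -> forall q, P q.
Proof. by move=> Px q; have := Px (repr (q : Quotient.quot I)); rewrite /lspi reprK. Qed.

Lemma lspiD x y : lspi (x + y) = lspi x + lspi y.
Proof. by rewrite /lspi (raddfD \pi_(Quotient.quot I)). Qed.

Lemma lspiN x : lspi (- x) = - lspi x.
Proof. by rewrite /lspi (raddfN \pi_(Quotient.quot I)). Qed.

Lemma lspi0 : lspi 0 = 0.
Proof. by rewrite /lspi (raddf0 \pi_(Quotient.quot I)). Qed.

Lemma lspi_repr x : repr (lspi x : Quotient.quot I) - x \in I.
Proof. by apply/lspi_eq; rewrite /lspi reprK. Qed.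

Definition lsquot_scale (a : F) (q : Q) : Q :=
  lspi (a *: repr (q : Quotient.quot I)).

Lemma lsquot_scaleE a x : lsquot_scale a (lspi x) = lspi (a *: x).
Proof. by apply/lspi_eq; rewrite -scalerBr; apply: gideal_scale; apply: lspi_repr. Qed.

Fact lsquot_scaleA a b q :
  lsquot_scale a (lsquot_scale b q) = lsquot_scale (a * b) q.
Proof. by elim/lspi_ind: q => x; rewrite !lsquot_scaleE scalerA. Qed.

Fact lsquot_scale1 : left_id 1 lsquot_scale.
Proof. by elim/lspi_ind => x; rewrite lsquot_scaleE scale1r. Qed.

Fact lsquot_scaleDr : right_distributive lsquot_scale +%R.
Proof.
move=> a; elim/lspi_ind=> x; elim/lspi_ind=> y.
by rewrite -lspiD !lsquot_scaleE scalerDr lspiD.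
Qed.

Fact lsquot_scaleDl q : {morph lsquot_scale^~ q : a b / a + b}.
Proof.
by elim/lspi_ind: q => x a b; rewrite !lsquot_scaleE scalerDl lspiD.
Qed.

HB.instance Definition _ := GRing.Zmodule_isLmodule.Build F Q
  lsquot_scaleA lsquot_scale1 lsquot_scaleDr lsquot_scaleDl.

Lemma lspiZ a x : lspi (a *: x) = a *: lspi x.
Proof. by rewrite -lsquot_scaleE. Qed.

Definition lsquot_br (q r : Q) : Q :=
  lspi (lsbr (repr (q : Quotient.quot I)) (repr (r : Quotient.quot I))).

Lemma lsquot_brE x y : lsquot_br (lspi x) (lspi y) = lspi (lsbr x y).
Proof.
apply/lspi_eq; set x' := repr _; set y' := repr _.
have -> : lsbr x' y' - lsbr x y = lsbr (x' - x) y' + lsbr x (y' - y).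
  by rewrite lsbrBl lsbrBr addrA subrK.
by apply: rpredD; [apply: gideal_brl|apply: gideal_brr]; apply: lspi_repr.
Qed.

Definition lsquot_deg (p : bool) (q : Q) : Prop :=
  exists2 x : L, lsdeg p x & q = lspi x.

Fact lsquot_deg0 p : lsquot_deg p 0.
Proof. by exists 0; [apply: lsdeg0|rewrite lspi0]. Qed.

Fact lsquot_degP p a q r :
  lsquot_deg p q -> lsquot_deg p r -> lsquot_deg p (a *: q + r).
Proof.
move=> [x px ->] [y py ->]; exists (a *: x + y); first exact: lsdegP.
by rewrite lspiD lspiZ.
Qed.

Fact lsquot_deg_sum q :
  exists q0 q1, [/\ lsquot_deg false q0, lsquot_deg true q1 & q = q0 + q1].
Proof.
elim/lspi_ind: q => x; have [x0 [x1 [d0 d1 ->]]] := lsdeg_sum x.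
by exists (lspi x0), (lspi x1); split; [exists x0|exists x1|rewrite lspiD].
Qed.

Fact lsquot_deg_direct q : lsquot_deg false q -> lsquot_deg true q -> q = 0.
Proof.
move=> [x0 d0 ->] [x1 d1 /lspi_eq Ix].
have /andP[Ix0 _] := gideal_graded x0 (- x1) d0 (lsdegN d1) Ix.
by rewrite -lspi0; apply/lspi_eq; rewrite subr0.
Qed.

Fact lsquot_br_linearr q : linear (lsquot_br q).
Proof.
elim/lspi_ind: q => x a; elim/lspi_ind=> y; elim/lspi_ind=> z.
by rewrite -lspiZ -lspiD !lsquot_brE lsbrDr lsbrZr lspiD lspiZ.
Qed.

Fact lsquot_br_linearl r : linear (lsquot_br^~ r).
Proof.
elim/lspi_ind: r => x a; elim/lspi_ind=> y; elim/lspi_ind=> z.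
by rewrite -lspiZ -lspiD !lsquot_brE lsbrDl lsbrZl lspiD lspiZ.
Qed.

Fact lsquot_br_deg p p' q r : lsquot_deg p q -> lsquot_deg p' r ->
  lsquot_deg (p (+) p') (lsquot_br q r).
Proof.
move=> [x px ->] [y py ->]; exists (lsbr x y); first exact: lsbr_deg.
by rewrite lsquot_brE.
Qed.

Fact lsquot_br_skew p p' q r : lsquot_deg p q -> lsquot_deg p' r ->
  lsquot_br q r = - ((-1) ^+ (p && p') *: lsquot_br r q).
Proof.
move=> [x px ->] [y py ->].
by rewrite !lsquot_brE (lsbr_skew px py) lspiN lspiZ.
Qed.

Fact lsquot_br_jacobi p p' q r s : lsquot_deg p q -> lsquot_deg p' r ->
  lsquot_br q (lsquot_br r s) = lsquot_br (lsquot_br q r) s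
    + (-1) ^+ (p && p') *: lsquot_br r (lsquot_br q s).
Proof.
move=> [x px ->] [y py ->]; elim/lspi_ind: s => z.
by rewrite !lsquot_brE (lsbr_jacobi z px py) lspiD lspiZ.
Qed.

Fact lsquot_br_even q : lsquot_deg false q -> lsquot_br q q = 0.
Proof. by move=> [x px ->]; rewrite lsquot_brE lsbr_even // lspi0. Qed.

Fact lsquot_br_odd q : lsquot_deg true q -> lsquot_br q (lsquot_br q q) = 0.
Proof. by move=> [x px ->]; rewrite !lsquot_brE lsbr_odd // lspi0. Qed.

HB.instance Definition _ := isLieSuperalgebra.Build F Q
  lsquot_deg0 lsquot_degP lsquot_deg_sum lsquot_deg_direct
  lsquot_br_linearr lsquot_br_linearl lsquot_br_deg lsquot_br_skew
  lsquot_br_jacobi lsquot_br_even lsquot_br_odd.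

End Quotient.

Definition lscenter (F : fieldType) (L : lieSuperalgType F) : pred L :=
  fun x => `[< forall y : L, lsbr x y = 0 >].

Definition lscenter2 (F : fieldType) (L : lieSuperalgType F) : pred L :=
  fun x => `[< forall y : L, lsbr x y \in @lscenter F L >].

Section Centers.
Variables (F : fieldType) (L : lieSuperalgType F).
Local Notation Z := (@lscenter F L).
Local Notation Z2 := (@lscenter2 F L).
Implicit Types x y : L.

Lemma lscenterP x : reflect (forall y, lsbr x y = 0) (x \in Z).
Proof. exact: asboolP. Qed.

Lemma lscenter2P x : reflect (forall y, lsbr x y \in Z) (x \in Z2).
Proof. exact: asboolP. Qed.

Fact lscenter_submod : submod_closed Z.
Proof.
split; first by apply/lscenterP=> y; rewrite lsbr0l.
move=> a x x' /lscenterP Zx /lscenterP Zx'; apply/lscenterP => y.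
by rewrite lsbrDl lsbrZl Zx Zx' scaler0 addr0.
Qed.
HB.instance Definition _ := GRing.isSubmodClosed.Build F L Z lscenter_submod.

Fact lscenter_graded x0 x1 : lsdeg false x0 -> lsdeg true x1 ->
  Z (x0 + x1) -> Z x0 && Z x1.
Proof.
move=> d0 d1 /lscenterP Zx.
suff H y : lsbr x0 y = 0 /\ lsbr x1 y = 0.
  by apply/andP; split; apply/lscenterP => y; case: (H y).
have K p z : lsdeg p z -> lsbr x0 z = 0 /\ lsbr x1 z = 0.
  move=> pz; apply: (@lsdeg_direct2 _ _ p); last by rewrite -lsbrDl.
    by rewrite -[p]addFb; apply: lsbr_deg.
  by rewrite -addTb; apply: lsbr_deg.
have [y0 [y1 [/K[e1 e2] /K[e3 e4] ->]]] := lsdeg_sum y.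
by rewrite !lsbrDr e1 e2 e3 e4 addr0.
Qed.

Fact lscenter_brr x y : Z x -> lsbr y x = 0.
Proof.
have [x0 [x1 [d0 d1 ->]]] := lsdeg_sum x.
move=> /(lscenter_graded d0 d1)/andP[/lscenterP Z0 /lscenterP Z1].
by rewrite lsbrDr (lsbr_skew0 (Z0 y) d0) (lsbr_skew0 (Z1 y) d1) addr0.
Qed.

Fact lscenter2_submod : submod_closed Z2.
Proof.
split; first by apply/lscenter2P=> y; rewrite lsbr0l rpred0.
move=> a x x' /lscenter2P Zx /lscenter2P Zx'; apply/lscenter2P => y.
by rewrite lsbrDl lsbrZl rpredD ?rpredZ.
Qed.
HB.instance Definition _ := GRing.isSubmodClosed.Build F L Z2 lscenter2_submod.

Lemma lscenter_sub2 x : x \in Z -> x \in Z2.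
Proof. by move=> /lscenterP Zx; apply/lscenter2P => y; rewrite Zx rpred0. Qed.

Fact lscenter2_graded x0 x1 : lsdeg false x0 -> lsdeg true x1 ->
  Z2 (x0 + x1) -> Z2 x0 && Z2 x1.
Proof.
move=> d0 d1 /lscenter2P Zx.
suff H y : lsbr x0 y \in Z /\ lsbr x1 y \in Z.
  by apply/andP; split; apply/lscenter2P => y; case: (H y).
have K p z : lsdeg p z -> lsbr x0 z \in Z /\ lsbr x1 z \in Z.
  move=> pz; have := Zx z; rewrite lsbrDl.
  have dz0 : lsdeg p (lsbr x0 z) by rewrite -[p]addFb; apply: lsbr_deg.
  have dz1 : lsdeg (~~ p) (lsbr x1 z) by rewrite -addTb; apply: lsbr_deg.
  case: p {pz} dz0 dz1 => dz0 dz1; last by move/(lscenter_graded dz0 dz1)/andP.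
  by rewrite addrC => /(lscenter_graded dz1 dz0)/andP[].
have [y0 [y1 [/K[e1 e2] /K[e3 e4] ->]]] := lsdeg_sum y.
by rewrite !lsbrDr !rpredD.
Qed.

Fact lscenter2_scale a x : Z2 x -> Z2 (a *: x).
Proof. by move=> Zx; apply: rpredZ. Qed.

Fact lscenter2_brl x y : Z2 x -> Z2 (lsbr x y).
Proof. by move=> /lscenter2P Zx; apply: lscenter_sub2. Qed.

Fact lscenter2_brr x y : Z2 x -> Z2 (lsbr y x).
Proof.
have [x0 [x1 [d0 d1 ->]]] := lsdeg_sum x.
have [y0 [y1 [c0 c1 ->]]] := lsdeg_sum y.
move=> /(lscenter2_graded d0 d1)/andP[/lscenter2P Z0 /lscenter2P Z1].
apply: lscenter_sub2; rewrite lsbrDr !lsbrDl.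
rewrite (lsbr_skew c0 d0) (lsbr_skew c1 d0) (lsbr_skew c0 d1) (lsbr_skew c1 d1).
by rewrite !(rpredD, rpredN, rpredZ).
Qed.

HB.instance Definition _ := isGradedIdeal.Build F L Z2
  lscenter2_scale lscenter2_brl lscenter2_brr lscenter2_graded.

End Centers.

Definition ls_isomorphic (F : fieldType) (L M : lieSuperalgType F) : Prop :=
  exists f : {linear L -> M},
    [/\ bijective f,
        forall p x, lsdeg p x -> lsdeg p (f x)
      & forall x y, f (lsbr x y) = lsbr (f x) (f y)].

(* H ranges over all Lie superalgebras, finite-dimensional or not *)
Definition two_capable (F : fieldType) (L : lieSuperalgType F) : Prop :=
  exists H : lieSuperalgType F, ls_isomorphic L (lsquot (@lscenter2 F H)).

(* The triple (a, b, c) stands for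
   \sum_j a_j x_j + \sum_j b_j y_j + c z, with x_j even and y_j, z odd. *)
Definition oddHeis (F : fieldType) (m : nat) : Type :=
  ('rV[F]_m * 'rV[F]_m * F^o)%type.

Section OddHeisenberg.
Variables (F : fieldType) (m : nat).
Local Notation Hm := (oddHeis F m).

HB.instance Definition _ := GRing.Lmodule.on Hm.

Definition oddHeis_deg (p : bool) (u : Hm) : Prop :=
  if p then u.1.1 = 0 else u.1.2 = 0 /\ u.2 = 0.

Definition oddHeis_br (u v : Hm) : Hm :=
  (0, 0, \sum_(j < m) (u.1.1 0 j * v.1.2 0 j - u.1.2 0 j * v.1.1 0 j)).

Let eqHm (u v : Hm) : u.1.1 = v.1.1 -> u.1.2 = v.1.2 -> u.2 = v.2 -> u = v.
Proof. by case: u v => [[? ?] ?] [[? ?] ?] /= -> -> ->. Qed.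

Let br_br0 (u v w : Hm) : oddHeis_br u (oddHeis_br v w) = 0.
Proof. by congr (_, _); rewrite big1 // => j _ /=; rewrite !mxE !mulr0 subrr. Qed.

Let br0_br (u v w : Hm) : oddHeis_br (oddHeis_br u v) w = 0.
Proof. by congr (_, _); rewrite big1 // => j _ /=; rewrite !mxE !mul0r subrr. Qed.

Fact oddHeis_deg0 p : oddHeis_deg p 0.
Proof. by case: p. Qed.

Fact oddHeis_degP p a (u v : Hm) :
  oddHeis_deg p u -> oddHeis_deg p v -> oddHeis_deg p (a *: u + v).
Proof.
case: p => /= [-> ->|[-> ->] [-> ->]]; first by rewrite scaler0 addr0.
by rewrite !scaler0 !addr0.
Qed.

Fact oddHeis_deg_sum (u : Hm) :
  exists u0 u1, [/\ oddHeis_deg false u0, oddHeis_deg true u1 & u = u0 + u1].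
Proof.
exists (u.1.1, 0, 0), (0, u.1.2, u.2); split=> //.
by apply: eqHm; rewrite /= ?addr0 ?add0r.
Qed.

Fact oddHeis_deg_direct (u : Hm) :
  oddHeis_deg false u -> oddHeis_deg true u -> u = 0.
Proof. by move=> /= [u2 u3] u1; apply: eqHm. Qed.

Fact oddHeis_br_linearr (u : Hm) : linear (oddHeis_br u).
Proof.
move=> a v w; apply: eqHm; rewrite /= ?scaler0 ?addr0 //.
rewrite /GRing.scale /= mulr_sumr -big_split; apply: eq_bigr => j _ /=.
by rewrite !mxE; ring.
Qed.

Fact oddHeis_br_linearl (u : Hm) : linear (oddHeis_br^~ u).
Proof.
move=> a v w; apply: eqHm; rewrite /= ?scaler0 ?addr0 //.
rewrite /GRing.scale /= mulr_sumr -big_split; apply: eq_bigr => j _ /=.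
by rewrite !mxE; ring.
Qed.

Fact oddHeis_br_deg p q (u v : Hm) : oddHeis_deg p u -> oddHeis_deg q v ->
  oddHeis_deg (p (+) q) (oddHeis_br u v).
Proof.
case: p q => [] [] //=.
  move=> u0 v0; split=> //; rewrite big1 // => j _.
  by rewrite u0 v0 !mxE mul0r mulr0 subrr.
move=> [u0 _] [v0 _]; split=> //; rewrite big1 // => j _.
by rewrite u0 v0 !mxE mul0r mulr0 subrr.
Qed.

Fact oddHeis_br_skew p q (u v : Hm) : oddHeis_deg p u -> oddHeis_deg q v ->
  oddHeis_br u v = - ((-1) ^+ (p && q) *: oddHeis_br v u).
Proof.
move=> pu qv; apply: eqHm; rewrite /= ?scaler0 ?oppr0 //.
rewrite /GRing.scale /= mulr_sumr -sumrN; apply: eq_bigr => j _ /=.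
case: p q pu qv => [] [] //=; try by rewrite expr0 => *; ring.
by move=> -> ->; rewrite !mxE; ring.
Qed.

Fact oddHeis_br_jacobi p q (u v w : Hm) : oddHeis_deg p u -> oddHeis_deg q v ->
  oddHeis_br u (oddHeis_br v w) = oddHeis_br (oddHeis_br u v) w
    + (-1) ^+ (p && q) *: oddHeis_br v (oddHeis_br u w).
Proof. by rewrite !br_br0 br0_br scaler0 addr0. Qed.

Fact oddHeis_br_even (u : Hm) : oddHeis_deg false u -> oddHeis_br u u = 0.
Proof.
move=> [u0 _]; congr (_, _); rewrite big1 // => j _.
by rewrite u0 !mxE mul0r mulr0 subrr.
Qed.

Fact oddHeis_br_odd (u : Hm) :
  oddHeis_deg true u -> oddHeis_br u (oddHeis_br u u) = 0.
Proof. by rewrite br_br0. Qed.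

HB.instance Definition _ := isLieSuperalgebra.Build F Hm
  oddHeis_deg0 oddHeis_degP oddHeis_deg_sum oddHeis_deg_direct
  oddHeis_br_linearr oddHeis_br_linearl oddHeis_br_deg oddHeis_br_skew
  oddHeis_br_jacobi oddHeis_br_even oddHeis_br_odd.

End OddHeisenberg.

(* Main.v *)
Require Import Defs.
From mathcomp Require Import all_boot all_algebra.
From HB Require Import structures.
From mathcomp Require Import boolp.

(** Why only [m = 1] survives.

    Suppose [L] is isomorphic to [H / Z_2(H)] and [z = [x, y]] with [x], [y]
    homogeneous.  If [w] commutes with [x] and [y] in the quotient, then its
    lift has brackets with the lifts of [x] and [y] in [Z_2(H)], and the Jacobi
    identity puts [[w, [x, y]]] in [[Z_2(H), H]], hence in the centre of [H].
    When [m >= 2], the central element [z] of [H_m] is a bracket in two ways,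
    [z = [x_1, y_1] = [x_2, y_2]], and each element of [H_m] is a sum of one
    that commutes with [x_1, y_1] and one that commutes with [x_2, y_2].  So the
    lift of [z] brackets all of [H] into the centre, i.e. it lies in [Z_2(H)],
    and [z = 0], which is absurd ([two_capable_bracket_eq0],
    [oddHeis_not_two_capable]).  No division takes place, so the
    argument holds in every characteristic.

    When [m = 1], take the filiform superalgebra with even generator [x], odd
    basis [v_1, v_2, v_3, v_4] and brackets [[x, v_i] = v_(i+1)].  Its
    centre is spanned by [v_4] and its second centre by [v_3, v_4]; what is left
    is [x, v_1, v_2] with [[x, v_1] = v_2], that is [H_1]
    ([oddHeis1_two_capable]).  It is the extension of an odd space, with zero
    bracket, by the derivation [x], and is built at that generality. *)

Set Implicit Arguments.
Unset Strict Implicit.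
Unset Printing Implicit Defensive.

Import GRing.Theory.
Local Open Scope ring_scope.

(** * The second centre and its quotient *)

Section SecondCenter.
Variables (F : fieldType) (H : lieSuperalgType F).
Local Notation Z := (@lscenter F H).
Local Notation Z2 := (@lscenter2 F H).
Local Notation pi := (@lspi F H Z2).
Implicit Types w x y : H.

Lemma lspi_eq0 x : pi x = 0 <-> x \in Z2.
Proof. by rewrite -(lspi0 Z2) lspi_eq subr0. Qed.

Lemma lspi_br x y : lsbr (pi x) (pi y) = pi (lsbr x y).
Proof. exact: lsquot_brE. Qed.

(** Membership in the centre is insensitive to the order of a bracket, because
    skew-symmetry on homogeneous components only changes signs; the right
    argument is split, and the left one has to be homogeneous already. *)
Lemma lscenter_skew p x : lsdeg p x ->
  (forall w, lsbr w x \in Z) -> forall w, lsbr x w \in Z.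
Proof.
move=> px Zx w; have [w0 [w1 [d0 d1 ->]]] := lsdeg_sum w.
by rewrite lsbrDr (lsbr_skew px d0) (lsbr_skew px d1) !(rpredD, rpredN, rpredZ).
Qed.

Lemma lscenter2_brr_lscenter x w : x \in Z2 -> lsbr w x \in Z.
Proof.
have [x0 [x1 [d0 d1 ->]]] := lsdeg_sum x.
have [w0 [w1 [c0 c1 ->]]] := lsdeg_sum w.
move=> /(lscenter2_graded d0 d1)/andP[/lscenter2P Z0 /lscenter2P Z1].
rewrite lsbrDr !lsbrDl (lsbr_skew c0 d0) (lsbr_skew c1 d0).
by rewrite (lsbr_skew c0 d1) (lsbr_skew c1 d1) !(rpredD, rpredN, rpredZ).
Qed.

Lemma lscenter2_br_components p w0 w1 x : lsdeg false w0 -> lsdeg true w1 ->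
  lsdeg p x -> lsbr (w0 + w1) x \in Z2 ->
  lsbr w0 x \in Z2 /\ lsbr w1 x \in Z2.
Proof.
move=> d0 d1 px; rewrite lsbrDl.
have dx0 : lsdeg p (lsbr w0 x) by rewrite -[p]addFb; apply: lsbr_deg.
have dx1 : lsdeg (~~ p) (lsbr w1 x) by rewrite -addTb; apply: lsbr_deg.
case: p {px} dx0 dx1 => dx0 dx1; last by move/(lscenter2_graded dx0 dx1)/andP.
by rewrite addrC => /(lscenter2_graded dx1 dx0)/andP[].
Qed.

(** The Jacobi identity writes [[w, [x, y]]] with brackets that have [[w, x]] or
    [[w, y]] as a factor, and [[Z_2, H]] is central.  That identity is for
    homogeneous [w], whence the reduction to components. *)
Lemma lscenter_br_br p q w x y : lsdeg p x -> lsdeg q y ->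
  lsbr w x \in Z2 -> lsbr w y \in Z2 -> lsbr w (lsbr x y) \in Z.
Proof.
move=> px qy.
have homog r v : lsdeg r v -> lsbr v x \in Z2 -> lsbr v y \in Z2 ->
    lsbr v (lsbr x y) \in Z.
  move=> rv /lscenter2P vx vy; rewrite (lsbr_jacobi y rv px).
  by apply: rpredD => //; apply: rpredZ; apply: lscenter2_brr_lscenter.
have [w0 [w1 [d0 d1 ->]]] := lsdeg_sum w.
move=> /(lscenter2_br_components d0 d1 px)[w0x w1x].
move=> /(lscenter2_br_components d0 d1 qy)[w0y w1y].
by rewrite lsbrDl rpredD ?(homog _ _ d0) ?(homog _ _ d1).
Qed.

End SecondCenter.

(** * An obstruction to 2-capability *)

(** The lift [[X1, Y1]] of the bracket is congruent to [[X2, Y2]] modulo the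
    second centre, and each summand of an arbitrary element kills, up to the
    centre, one of these two lifts. *)
Lemma two_capable_bracket_eq0 (F : fieldType) (L : lieSuperalgType F)
    (p1 q1 p2 q2 : bool) (x1 y1 x2 y2 : L) :
    two_capable L ->
    lsdeg p1 x1 -> lsdeg q1 y1 -> lsdeg p2 x2 -> lsdeg q2 y2 ->
    lsbr x1 y1 = lsbr x2 y2 ->
    (forall u, exists u1 u2, [/\ u = u1 + u2,
       lsbr u1 x1 = 0 /\ lsbr u1 y1 = 0 & lsbr u2 x2 = 0 /\ lsbr u2 y2 = 0]) ->
  lsbr x1 y1 = 0.
Proof.
move=> [H [f [[g fK gK] fdeg fbr]]] /fdeg[X1 dX1 eX1] /fdeg[Y1 dY1 eY1].
move=> /fdeg[X2 dX2 eX2] /fdeg[Y2 dY2 eY2] eqbr decomp.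
have commute u U x X : f u = lspi _ U -> f x = lspi _ X -> lsbr u x = 0 ->
    lsbr U X \in lscenter2 (L := H).
  by move=> eU eX ux0; apply/lspi_eq0; rewrite -lspi_br -eU -eX -fbr ux0 linear0.
apply: (can_inj fK); rewrite linear0 fbr eX1 eY1 lspi_br; apply/lspi_eq0.
have eqBR : lsbr X1 Y1 - lsbr X2 Y2 \in lscenter2 (L := H).
  by apply/lspi_eq; rewrite -!lspi_br -eX1 -eX2 -eY1 -eY2 -!fbr eqbr.
have dXY : lsdeg (p1 (+) q1) (lsbr X1 Y1) by apply: lsbr_deg.
apply/lscenter2P; apply: (lscenter_skew dXY) => h.
have [u1 [u2 [eu [u1x u1y] [u2x u2y]]]] := decomp (g (lspi _ h)).
have [U1 eU1] : exists U, f u1 = lspi _ U by elim/lspi_ind: (f u1) => U; exists U.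
have eU2 : f u2 = lspi _ (h - U1).
  by rewrite lspiD lspiN -eU1 -[lspi _ h]gK eu linearD addrC addKr.
rewrite -[h](subrKC U1) lsbrDl rpredD //.
  apply: lscenter_br_br dX1 dY1 _ _.
    by apply: commute eU1 eX1 _.
  by apply: commute eU1 eY1 _.
rewrite -(subrK (lsbr X2 Y2) (lsbr X1 Y1)) lsbrDr rpredD //.
  exact: lscenter2_brr_lscenter.
apply: lscenter_br_br dX2 dY2 _ _.
  by apply: commute eU2 eX2 _.
by apply: commute eU2 eY2 _.
Qed.

Section OddHeisenberg.
Variables (F : fieldType) (m : nat).
Local Notation Hm := (oddHeis F m).

Definition oddHeis_x (i : 'I_m) : Hm := (delta_mx 0 i, 0, 0).
Definition oddHeis_y (i : 'I_m) : Hm := (0, delta_mx 0 i, 0).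

Lemma oddHeis_brx (u : Hm) i : lsbr u (oddHeis_x i) = (0, 0, - u.1.2 0 i).
Proof.
congr (_, _); rewrite (bigD1 i) //= big1 => [|j ji]; rewrite !mxE ?eqxx.
  by rewrite mulr0 mulr1 add0r addr0.
by rewrite (negPf ji) !mulr0 subrr.
Qed.

Lemma oddHeis_bry (u : Hm) i : lsbr u (oddHeis_y i) = (0, 0, u.1.1 0 i).
Proof.
congr (_, _); rewrite (bigD1 i) //= big1 => [|j ji]; rewrite !mxE ?eqxx.
  by rewrite mulr0 mulr1 subr0 addr0.
by rewrite (negPf ji) !mulr0 subrr.
Qed.

Lemma oddHeis_brxy i : lsbr (oddHeis_x i) (oddHeis_y i) = (0, 0, 1) :> Hm.
Proof. by rewrite oddHeis_bry mxE !eqxx. Qed.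

Lemma oddHeis_commute (u : Hm) i : u.1.1 0 i = 0 -> u.1.2 0 i = 0 ->
  lsbr u (oddHeis_x i) = 0 /\ lsbr u (oddHeis_y i) = 0.
Proof. by move=> u1 u2; rewrite oddHeis_brx oddHeis_bry u1 u2 oppr0. Qed.

(** For [i != j] the pairs [x_i, y_i] and [x_j, y_j] have the same bracket, and
    removing the [x_i]- and [y_i]-components of a vector gives the
    decomposition that the obstruction asks for. *)
Lemma oddHeis_not_two_capable : (1 < m)%N -> ~ two_capable Hm.
Proof.
move=> m_gt1 cap.
pose i := Ordinal (ltnW m_gt1); pose j := Ordinal m_gt1.
have ji : (j == i) = false by [].
suff /(congr1 (@snd _ _))/eqP : lsbr (oddHeis_x i) (oddHeis_y i) = 0 :> Hm.
  by rewrite oddHeis_brxy /= oner_eq0.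
apply: (@two_capable_bracket_eq0 _ _ false true false true _ _
  (oddHeis_x j) (oddHeis_y j)) => // [|u]; first by rewrite !oddHeis_brxy.
pose u2 : Hm := (u.1.1 0 i *: delta_mx 0 i, u.1.2 0 i *: delta_mx 0 i, 0).
exists (u - u2), u2; split; first by rewrite subrK.
  by apply: oddHeis_commute; rewrite /= !mxE !eqxx mulr1 subrr.
by apply: oddHeis_commute; rewrite /= !mxE ji mulr0.
Qed.

End OddHeisenberg.

(** * Extending an odd space by an even derivation *)

(** The pair [(a, v)] stands for [a x + v] with [x] even and [v] odd. *)
Definition oddExt (F : fieldType) (V : lmodType F) (D : {linear V -> V}) : Type :=
  (F^o * V)%type.

Section OddExtension.
Variables (F : fieldType) (V : lmodType F) (D : {linear V -> V}).
Local Notation E := (oddExt D).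

HB.instance Definition _ := GRing.Lmodule.on E.

Definition oddExt_deg (p : bool) (u : E) : Prop :=
  if p then u.1 = 0 else u.2 = 0.

Definition oddExt_br (u v : E) : E :=
  (0, (u.1 : F) *: D v.2 - (v.1 : F) *: D u.2).

Let eqE (u v : E) : u.1 = v.1 -> u.2 = v.2 -> u = v.
Proof. by case: u v => [? ?] [? ?] /= -> ->. Qed.

Fact oddExt_deg0 p : oddExt_deg p 0.
Proof. by case: p. Qed.

Fact oddExt_degP p a (u v : E) :
  oddExt_deg p u -> oddExt_deg p v -> oddExt_deg p (a *: u + v).
Proof. by case: p => /= -> ->; rewrite scaler0 addr0. Qed.

Fact oddExt_deg_sum (u : E) :
  exists u0 u1, [/\ oddExt_deg false u0, oddExt_deg true u1 & u = u0 + u1].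
Proof.
by exists (u.1, 0), (0, u.2); split=> //; apply: eqE; rewrite /= ?addr0 ?add0r.
Qed.

Fact oddExt_deg_direct (u : E) :
  oddExt_deg false u -> oddExt_deg true u -> u = 0.
Proof. by move=> /= u2 u1; apply: eqE. Qed.

Fact oddExt_br_linearr (u : E) : linear (oddExt_br u).
Proof.
move=> a v w; apply: eqE; rewrite /= ?scaler0 ?addr0 //.
rewrite linearP scalerDr scalerDl -scalerA scalerBr !scalerA (mulrC u.1).
by rewrite opprD addrACA.
Qed.

Fact oddExt_br_linearl (u : E) : linear (oddExt_br^~ u).
Proof.
move=> a v w; apply: eqE; rewrite /= ?scaler0 ?addr0 //.
rewrite linearP scalerDr scalerDl -scalerA scalerBr !scalerA (mulrC u.1).
by rewrite opprD addrACA.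
Qed.

Fact oddExt_br_deg p q (u v : E) : oddExt_deg p u -> oddExt_deg q v ->
  oddExt_deg (p (+) q) (oddExt_br u v).
Proof.
case: p q => [] [] //= -> ->; first by rewrite !scale0r subrr.
by rewrite !linear0 addr0.
Qed.

Fact oddExt_br_skew p q (u v : E) : oddExt_deg p u -> oddExt_deg q v ->
  oddExt_br u v = - ((-1) ^+ (p && q) *: oddExt_br v u).
Proof.
move=> pu qv; apply: eqE; rewrite /= ?scaler0 ?oppr0 //.
case: p q pu qv => [] [] //=; try by rewrite expr0 scale1r opprB.
by move=> -> ->; rewrite !scale0r subrr scaler0 oppr0.
Qed.

Fact oddExt_br_jacobi p q (u v w : E) : oddExt_deg p u -> oddExt_deg q v ->
  oddExt_br u (oddExt_br v w) = oddExt_br (oddExt_br u v) w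
    + (-1) ^+ (p && q) *: oddExt_br v (oddExt_br u w).
Proof.
move=> pu qv; apply: eqE; rewrite /= ?scaler0 ?addr0 //.
rewrite !scale0r !subr0 sub0r.
have [/andP[pT qT]|_] := boolP (p && q).
  move: pu qv; rewrite pT qT /= => -> ->.
  by rewrite !scale0r subrr linear0 !scaler0 oppr0 addr0.
have DE a b (x y : V) : D (a *: x - b *: y) = a *: D x - b *: D y.
  by rewrite linearB !linearZ.
rewrite scale1r !DE !scalerBr !scalerA opprB.
rewrite (mulrC v.1 u.1) (mulrC w.1 u.1) (mulrC w.1 v.1).
by rewrite [RHS]addrC addrA subrK.
Qed.

Fact oddExt_br_even (u : E) : oddExt_deg false u -> oddExt_br u u = 0.
Proof. by move=> _; rewrite /oddExt_br subrr. Qed.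

Fact oddExt_br_odd (u : E) :
  oddExt_deg true u -> oddExt_br u (oddExt_br u u) = 0.
Proof. by rewrite /= /oddExt_br /= => ->; rewrite !scale0r subrr. Qed.

HB.instance Definition _ := isLieSuperalgebra.Build F E
  oddExt_deg0 oddExt_degP oddExt_deg_sum oddExt_deg_direct
  oddExt_br_linearr oddExt_br_linearl oddExt_br_deg oddExt_br_skew
  oddExt_br_jacobi oddExt_br_even oddExt_br_odd.

Lemma oddExt_center (u : E) : (exists v, D v != 0) ->
  u \in @lscenter F E <-> u.1 = 0 /\ D u.2 = 0.
Proof.
move=> [v Dv]; split=> [/lscenterP Zu|[u1 Du]].
  split.
    have /(congr1 (@snd _ _))/eqP := Zu (0, v).
    by rewrite /= scale0r subr0 scaler_eq0 (negPf Dv) orbF => /eqP.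
  have /(congr1 (@snd _ _))/eqP := Zu (1, 0).
  by rewrite /= linear0 scaler0 scale1r sub0r oppr_eq0 => /eqP.
by apply/lscenterP => w; apply: eqE; rewrite //= u1 Du scale0r scaler0 subrr.
Qed.

Lemma oddExt_center2 (u : E) : (exists v, D (D v) != 0) ->
  u \in @lscenter2 F E <-> u.1 = 0 /\ D (D u.2) = 0.
Proof.
move=> [v DDv].
have ZE w : w \in @lscenter F E <-> w.1 = 0 /\ D w.2 = 0.
  by apply: oddExt_center; exists (D v).
split=> [/lscenter2P Zu|[u1 Du]].
  split.
    have /ZE[_ /eqP] := Zu (0, v).
    by rewrite /= scale0r subr0 linearZ scaler_eq0 (negPf DDv) orbF => /eqP.
  have /ZE[_ /eqP] := Zu (1, 0).
  by rewrite /= linear0 scaler0 scale1r sub0r linearN oppr_eq0 => /eqP.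
apply/lscenter2P => w; apply/ZE; split=> //=.
by rewrite u1 scale0r sub0r linearN linearZ /= Du scaler0 oppr0.
Qed.

End OddExtension.

(** * The three-dimensional odd Heisenberg superalgebra *)

(** Presenting [L] as a graded complement of [Z_2(H)] avoids representatives of
    cosets: the isomorphism is the complement followed by the projection. *)
Lemma two_capable_complement (F : fieldType) (L H : lieSuperalgType F)
    (s : {linear L -> H}) :
    (forall p u, lsdeg p u -> lsdeg p (s u)) ->
    (forall u v, s (lsbr u v) - lsbr (s u) (s v) \in lscenter2 (L := H)) ->
    (forall u, s u \in lscenter2 (L := H) -> u = 0) ->
    (forall h, exists u, h - s u \in lscenter2 (L := H)) ->
  two_capable L.
Proof.
move=> sdeg sbr s_inj s_surj; exists H.
pose f u := lspi (@lscenter2 F H) (s u).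
have lin_f : linear f by move=> a u v; rewrite /f linearP lspiD lspiZ.
pose f_lin := GRing.isLinear.Build _ _ _ _ f lin_f.
pose fL : {linear L -> lsquot (@lscenter2 F H)} := HB.pack f f_lin.
have f_inj : injective f.
  by move=> u v /lspi_eq; rewrite -linearB => /s_inj/eqP; rewrite subr_eq0 => /eqP.
have f_surj q : exists u, f u = q.
  elim/lspi_ind: q => h; have [u hu] := s_surj h.
  by exists u; apply/esym/lspi_eq.
have [g gK] := choice f_surj.
exists fL; split=> [|p u pu|u v].
- by exists g => // u; apply: f_inj; rewrite gK.
- by exists (s u) => //; apply: sdeg.
by rewrite /= /f lspi_br; apply/lspi_eq.
Qed.

Section Filiform.
Variable F : fieldType.
Local Notation V := (F^o * F^o * F^o * F^o)%type.

Definition shift4 (v : V) : V := (0, v.1.1.1, v.1.1.2, v.1.2).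

Fact shift4_linear : linear shift4.
Proof. by move=> a u v; rewrite /shift4 /=; congr (_, _, _, _); rewrite /= scaler0 addr0. Qed.
HB.instance Definition _ := GRing.isLinear.Build F V V _ shift4 shift4_linear.

Local Notation E := (oddExt shift4).

Definition oddHeis1_lift (u : oddHeis F 1) : E :=
  (u.1.1 0 0, (u.1.2 0 0, u.2, 0, 0)).

Fact oddHeis1_lift_linear : linear oddHeis1_lift.
Proof.
move=> a u v; rewrite /oddHeis1_lift /= !mxE.
by congr (_, (_, _, _, _)); rewrite /= scaler0 addr0.
Qed.
HB.instance Definition _ :=
  GRing.isLinear.Build F (oddHeis F 1) E _ oddHeis1_lift oddHeis1_lift_linear.

Lemma filiform_center2 (u : E) : u \in @lscenter2 F E <->
  [/\ u.1 = 0, u.2.1.1.1 = 0 & u.2.1.1.2 = 0].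
Proof.
rewrite oddExt_center2.
  split=> [[u1 DDu]|[u1 u2 u3]]; last first.
    by split=> //; congr (_, _, _, _).
  split=> //; first exact: (congr1 (fun v : V => v.1.2) DDu).
  exact: (congr1 (fun v : V => v.2) DDu).
exists (1, 0, 0, 0); apply/eqP => /(congr1 (fun v : V => v.1.2))/eqP.
by rewrite oner_eq0.
Qed.

Lemma oddHeis1_two_capable : two_capable (oddHeis F 1).
Proof.
apply: (@two_capable_complement F _ E oddHeis1_lift).
- case=> u; rewrite /lsdeg /=; first by move=> u1; rewrite u1 mxE.
  by move=> [u2 u3]; rewrite u2 u3 mxE.
- move=> u v; apply/filiform_center2; rewrite /= !mxE big_ord1 !scaler0.
  split; rewrite ?subrr ?subr0 //; apply/eqP; rewrite subr_eq0; apply/eqP.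
  by congr (_ - _); apply: mulrC.
- move=> [[a b] c] /filiform_center2[/= a0 b0 c0].
  by congr (_, _, _) => //; apply/rowP => i; rewrite ord1 mxE.
move=> h; exists (const_mx h.1, const_mx h.2.1.1.1, h.2.1.1.2).
by apply/filiform_center2; rewrite /= !mxE !subrr.
Qed.

End Filiform.

Theorem theorem6p8 (F : closedFieldType) (m : nat) (hm : (1 <= m)%N) :
  two_capable (oddHeis F m) <-> m = 1%N.
Proof.
split=> [cap|->]; last exact: oddHeis1_two_capable.
apply/eqP; rewrite eqn_leq hm andbT leqNgt; apply/negP => m_gt1.
exact: (oddHeis_not_two_capable m_gt1 cap).
Qed.
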